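(* Let $\varepsilon>0$ be the step size of the general auction method (defined in the context), applied to a discrete optimal transport problem $\mathcal{T}$ with real-valued data. If a feasible transport plan exists, then when the general auction method terminates, the resulting feasible transport plan is within $L\varepsilon$ of optimal, where $$L=\sum_{i=1}^M d_i=\sum_{j=1}^N s_j.$$ That is, if $f_{ij}$ are the flows of the resulting plan and $P^*$ is the optimal primal cost of $\mathcal{T}$, then $$P^*-\sum_{(i,j)\in\mathcal{A}}c_{ij}f_{ij}\le L\varepsilon.$$
   Context: **Transport problem.** A discrete optimal transport problem $\mathcal{T}$ consists of sinks (bidders) $i\in I=\{1,\dots,M\}$ with real demands $d_i>0$, sources (lots) $j\in J=\{1,\dots,N\}$ with real supplies $s_j>0$ such that $\sum_i d_i=\sum_j s_j>0$, a nonempty set $A(i)\subseteq J$ of sources adjacent to each sink $i$, the arc set $\mathcal{A}=\{(i,j): j\in A(i)\}$, and real costs $c_{ij}<0$ for $(i,j)\in\mathcal{A}$. The problem is to maximize the primal cost $\sum_{(i,j)\in\mathcal{A}}c_{ij}f_{ij}$ subject to $\sum_{j\in A(i)}f_{ij}=d_i$ for all $i$, $\sum_{i: j\in A(i)}f_{ij}=s_j$ for all $j$, and $0\le f_{ij}\le\min\{d_i,s_j\}$; the maximum value is the optimal primal cost $P^*$. A feasible (complete) transport plan is a set of flows $\{f_{ij}\}$ satisfying these constraints, i.e. one for which all sinks are satisfied. **General auction method.** Given a step size $\varepsilon>0$ and initial lot prices $p_j^0\ge 0$. Each lot $j$ has a claim list $C_j$ of claims $(i;\,b_{ij},\,q_{ij})$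 (bidder, bid price, quantity). The lot price is $p_j:=\min_{(i;b_{ij},q_{ij})\in C_j} b_{ij}$, or $p_j^0$ if $C_j$ is empty. $D_i$ denotes the unsatisfied demand of sink $i$ ($d_i$ minus the total quantity it has claimed), and $S_j$ the available supply of lot $j$ ($s_j$ minus the total quantity claimed in $C_j$). Initially all claim lists are empty, $D_i=d_i$ and $S_j=s_j$. A sink is satisfied if $D_i=0$ and unsatisfied otherwise. The method performs iterations and terminates when all sinks are satisfied; the resulting plan has flows $f_{ij}:=\sum_{(i;b_{ij},q_{ij})\in C_j}q_{ij}$ (zero if $C_j$ has no claim by $i$). Each iteration consists of two phases. *Bidding phase.* Choose a nonempty set $\tilde I$ of unsatisfied sinks. For each $i\in\tilde I$, find a lot $j_i\in\arg\max_{j\in A(i)}\{c_{ij}-p_j\}$ and $w_i:=\max_{j\in A(i),\,j\ne j_i}\{c_{ij}-p_j\}$ (if $A(i)=\{j_i\}$, $w_i:=-\infty$, which for computational purposes can be any value satisfying $w_i\ll c_{ij_i}-p_{j_i}$). Sink $i$ bids $(b_{ij_i},q_{ij_i})$ on $j_i$, where $b_{ij_i}:=c_{ij_i}-w_i+\varepsilon$ and $q_{ij_i}:=\min\{D_i,s_{j_i}\}$. *Claims phase.* For each lot $j$ that received bids, and for each sink $i$ that bid $(b_{ij},q_{ij})$ on $j$, in turn: 1. While $S_j<q_{ij}$, $p_j\le b_{ij}$ and $C_j\neq\varnothing$: (a) take a lowest-priced claim $c=(k;b_{kj},q_{kj})$ in $C_j$; (b) if $k=i$, add the quantity $q_{kj}$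 of $c$ to the desired quantity $q_{ij}$ of the new bid (Hungry Cannibal rule); (c) let $q:=\min\{q_{ij},q_{kj}\}$; (d) add $q$ to $S_j$, subtract $q$ from the quantity of $c$, remove $c$ from $C_j$ and update $p_j$ if the quantity of $c$ is now $0$, and add $q$ to $D_k$. 2. Replace $q_{ij}$ by $\min\{q_{ij},S_j\}$. If it is positive, insert $(i;b_{ij},q_{ij})$ into $C_j$, subtract $q_{ij}$ from $D_i$ and from $S_j$, and update $p_j$. *)

(* Defs.v *)
From HB Require Import structures.
From mathcomp Require Import all_boot all_order all_algebra.
From mathcomp Require Import reals.

Set Implicit Arguments.
Unset Strict Implicit.
Unset Printing Implicit Defensive.

Import Order.TTheory GRing.Theory Num.Theory.
Local Open Scope ring_scope.

(* Sinks are indexed by 'I_M and sources by 'I_N; the values of [cost]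
   (and of flows) outside the arc set {(i, j) | j \in adj i} are irrelevant. *)
Record transport_problem (R : realType) (M N : nat) := TransportProblem {
  demand : 'I_M -> R;
  supply : 'I_N -> R;
  adj : 'I_M -> {set 'I_N};
  cost : 'I_M -> 'I_N -> R;
  demand_gt0 : forall i, 0 < demand i;
  supply_gt0 : forall j, 0 < supply j;
  balanced : \sum_i demand i = \sum_j supply j;
  total_gt0 : 0 < \sum_i demand i;
  adj_neq0 : forall i, adj i != set0;
  cost_lt0 : forall i j, j \in adj i -> cost i j < 0
}.

Definition primal_cost (R : realType) (M N : nat) (T : transport_problem R M N)
    (f : 'I_M -> 'I_N -> R) : R :=
  \sum_i \sum_(j in adj T i) cost T i j * f i j.

Definition feasible_plan (R : realType) (M N : nat)
    (T : transport_problem R M N) (f : 'I_M -> 'I_N -> R) : Prop :=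
  [/\ forall i, \sum_(j in adj T i) f i j = demand T i,
      forall j, \sum_(i | j \in adj T i) f i j = supply T j &
      forall i j, j \in adj T i ->
        0 <= f i j <= Num.min (demand T i) (supply T j)].

Definition is_max (R : realType) (A : R -> Prop) (m : R) : Prop :=
  A m /\ forall x, A x -> x <= m.

Definition optimal_primal_cost (R : realType) (M N : nat)
    (T : transport_problem R M N) (P : R) : Prop :=
  is_max (fun x => exists2 f, feasible_plan T f & x = primal_cost T f) P.

Record claim (R : realType) (M : nat) := Claim {
  bidder : 'I_M;
  bid_price : R;
  quantity : R
}.

(* A claim list is a multiset of claims: the order of the sequence plays no
   role below, and one bidder may hold several claims on the same lot. *)
Record auction_state (R : realType) (M N : nat) := AuctionState {
  claims : 'I_N -> seq (claim R M);
  unsatisfied : 'I_M -> R;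
  available : 'I_N -> R
}.

Definition initial_state (R : realType) (M N : nat)
    (T : transport_problem R M N) : auction_state R M N :=
  AuctionState (fun=> [::]) (demand T) (supply T).

(* As the price is a function of the current claim list, every change of the
   claim list updates it. *)
Definition lot_price (R : realType) (M N : nat) (p0 : 'I_N -> R)
    (st : auction_state R M N) (j : 'I_N) : R :=
  if claims st j is c :: C
  then \big[Num.min/bid_price c]_(c' <- C) bid_price c' else p0 j.

Definition margin (R : realType) (M N : nat) (T : transport_problem R M N)
    (p0 : 'I_N -> R) (st : auction_state R M N) (i : 'I_M) (j : 'I_N) : R :=
  cost T i j - lot_price p0 st j.

Definition best_lot (R : realType) (M N : nat) (T : transport_problem R M N)
    (p0 : 'I_N -> R) (st : auction_state R M N) (i : 'I_M) (j : 'I_N) : Prop :=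
  j \in adj T i /\
  forall k, k \in adj T i -> margin T p0 st i k <= margin T p0 st i j.

(* When [j] is the only source adjacent to [i] there is no second best margin;
   [w] is then an arbitrary real below the best margin, which stands in for
   minus infinity and keeps bid prices finite. *)
Definition second_margin (R : realType) (M N : nat)
    (T : transport_problem R M N) (p0 : 'I_N -> R) (st : auction_state R M N)
    (i : 'I_M) (j : 'I_N) (w : R) : Prop :=
  if adj T i == [set j] then (w < margin T p0 st i j : Prop)
  else is_max
    (fun x => exists k, [/\ k \in adj T i, k != j & x = margin T p0 st i k]) w.

Definition take_from_claim (R : realType) (M N : nat) (st : auction_state R M N)
    (j : 'I_N) (C1 : seq (claim R M)) (c : claim R M) (C2 : seq (claim R M))
    (r : R) : auction_state R M N :=
  let rest := quantity c - r in
  let c' := if rest == 0 then [::]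
            else [:: Claim (bidder c) (bid_price c) rest] in
  AuctionState
    [eta claims st with j |-> C1 ++ c' ++ C2]
    [eta unsatisfied st with bidder c |-> unsatisfied st (bidder c) + r]
    [eta available st with j |-> available st j + r].

(* Step 1 of the claims phase for a bid of sink [i] on lot [j] at price [b]:
   [make_room p0 i j b st q st' q'] says that the loop, started in state [st]
   with desired quantity [q], stops in state [st'] with desired quantity [q']. *)
Inductive make_room (R : realType) (M N : nat) (p0 : 'I_N -> R)
    (i : 'I_M) (j : 'I_N) (b : R) :
    auction_state R M N -> R -> auction_state R M N -> R -> Prop :=
| make_room_stop st q :
    ~ [/\ available st j < q, lot_price p0 st j <= b & claims st j <> [::]] ->
    make_room p0 i j b st q st q
| make_room_step st q C1 c C2 st' q' :
    available st j < q ->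
    lot_price p0 st j <= b ->
    claims st j = C1 ++ c :: C2 ->
    all (fun c' => bid_price c <= bid_price c') (claims st j) ->
    let q1 := if bidder c == i then q + quantity c else q in
    let r := Num.min q1 (quantity c) in
    make_room p0 i j b (take_from_claim st j C1 c C2 r) q1 st' q' ->
    make_room p0 i j b st q st' q'.

Definition place_claim (R : realType) (M N : nat) (st : auction_state R M N)
    (i : 'I_M) (j : 'I_N) (b q : R) : auction_state R M N :=
  let r := Num.min q (available st j) in
  if 0 < r then
    AuctionState
      [eta claims st with j |-> Claim i b r :: claims st j]
      [eta unsatisfied st with i |-> unsatisfied st i - r]
      [eta available st with j |-> available st j - r]
  else st.

Definition process_bid (R : realType) (M N : nat) (p0 : 'I_N -> R)
    (i : 'I_M) (j : 'I_N) (b q : R) (st st' : auction_state R M N) : Prop :=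
  exists st1 q1,
    make_room p0 i j b st q st1 q1 /\ st' = place_claim st1 i j b q1.

(* [process_bids p0 lot b q s st st'] : the bids ([b i], [q i]) of the sinks
   [i] in [s], each on lot [lot i], are processed in the order of [s]. *)
Inductive process_bids (R : realType) (M N : nat) (p0 : 'I_N -> R)
    (lot : 'I_M -> 'I_N) (b q : 'I_M -> R) :
    seq 'I_M -> auction_state R M N -> auction_state R M N -> Prop :=
| process_bids_nil st : process_bids p0 lot b q [::] st st
| process_bids_cons i s st st1 st' :
    process_bid p0 i (lot i) (b i) (q i) st st1 ->
    process_bids p0 lot b q s st1 st' ->
    process_bids p0 lot b q (i :: s) st st'.

(* The lots that received bids are visited in an arbitrary order [js], and the
   bids on lot [j] are processed in an arbitrary order [ord j]. *)
Definition claims_phase (R : realType) (M N : nat) (p0 : 'I_N -> R)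
    (It : {set 'I_M}) (lot : 'I_M -> 'I_N) (b q : 'I_M -> R)
    (st st' : auction_state R M N) : Prop :=
  exists (js : seq 'I_N) (ord : 'I_N -> seq 'I_M),
    [/\ perm_eq js (enum (lot @: It)),
        forall j, perm_eq (ord j) (enum [set i in It | lot i == j]) &
        process_bids p0 lot b q (flatten [seq ord j | j <- js]) st st'].

(* All bids are computed from the state [st] in which the iteration starts.
   The values of [lot] and [w] outside [It] are irrelevant. *)
Definition iteration (R : realType) (M N : nat) (T : transport_problem R M N)
    (p0 : 'I_N -> R) (eps : R) (st st' : auction_state R M N) : Prop :=
  exists (It : {set 'I_M}) (lot : 'I_M -> 'I_N) (w : 'I_M -> R),
    [/\ It != set0,
        forall i, i \in It -> unsatisfied st i <> 0,
        forall i, i \in It -> best_lot T p0 st i (lot i),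
        forall i, i \in It -> second_margin T p0 st i (lot i) (w i) &
        claims_phase p0 It lot
          (fun i => cost T i (lot i) - w i + eps)
          (fun i => Num.min (unsatisfied st i) (supply T (lot i)))
          st st'].

Inductive reachable (R : realType) (M N : nat) (T : transport_problem R M N)
    (p0 : 'I_N -> R) (eps : R) : auction_state R M N -> Prop :=
| reachable_init : reachable T p0 eps (initial_state T)
| reachable_step st st' :
    reachable T p0 eps st -> iteration T p0 eps st st' ->
    reachable T p0 eps st'.

Definition terminates_in (R : realType) (M N : nat)
    (T : transport_problem R M N) (p0 : 'I_N -> R) (eps : R)
    (st : auction_state R M N) : Prop :=
  reachable T p0 eps st /\ forall i, unsatisfied st i = 0.

Definition resulting_plan (R : realType) (M N : nat)
    (st : auction_state R M N) (i : 'I_M) (j : 'I_N) : R :=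
  \sum_(c <- claims st j | bidder c == i) quantity c.

(* Main.v *)
Require Import Defs.
From mathcomp Require Import all_boot all_order all_algebra.
From mathcomp Require Import reals lra.
Set Implicit Arguments.
Unset Strict Implicit.
Unset Printing Implicit Defensive.

Import Order.TTheory GRing.Theory Num.Theory.
Local Open Scope ring_scope.

(** The proof is linear programming duality.  Read the final lot prices [p] as
    a dual solution and let [u i] be the best margin [cost i k - p k] that sink
    [i] sees.  Any feasible plan costs at most
    [\sum_i demand i * u i + \sum_j supply j * p j] (lemma [dual_bound]).  If a
    plan uses only arcs whose margin is within [eps] of the best one of their
    sink (complementary slackness up to [eps]), each unit that it ships loses
    at most [eps] against this bound, so the plan loses at most [eps] times
    the total demand (lemma [slackness_gap]).

    It remains to see that the auction maintains this slackness at the end of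
    every iteration. A sink [i] that claims lot [j] at price [b] has chosen
    [b] so that its margin [cost i j - b] at that price falls short of the
    best margin on the other lots, if there are any, by exactly [eps]. The
    price of [j] is at most [b] as long as the claim is held, and the
    slackness persists as long as the prices of the other lots do not
    decrease. So the crux is that no price is lower at the end of an iteration
    than at its start. Inside an iteration prices are not monotone: bids on
    one lot are computed from the same old prices and a low one may be
    inserted after a high one, and a claim list may become empty for a while.
    Therefore everything is compared with the prices [pi] at the start of the
    iteration: every bid of the iteration exceeds [pi], and a lot that has
    been emptied is entirely available, so the bid that emptied it is placed
    on it (lemma [sound_process_bid]).

    The other half is bookkeeping.  Quantities are conserved, nothing becomes
    negative, and when all sinks are satisfied the balance of demand and
    supply forces all lots to be exhausted; hence the plan is feasible. *)

(** * Weak duality *)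

Lemma primal_cost_split (R : realType) (M N : nat)
    (T : transport_problem R M N) (u : 'I_M -> R) (p : 'I_N -> R)
    (f : 'I_M -> 'I_N -> R) :
  feasible_plan T f ->
  primal_cost T f = \sum_i demand T i * u i + \sum_j supply T j * p j
    - \sum_i \sum_(j in adj T i) (u i + p j - cost T i j) * f i j.
Proof.
move=> [fd fs _].
have -> : \sum_i demand T i * u i = \sum_i \sum_(j in adj T i) u i * f i j.
  by apply: eq_bigr => i _; rewrite -big_distrr /= fd mulrC.
have -> : \sum_j supply T j * p j = \sum_i \sum_(j in adj T i) p j * f i j.
  rewrite (exchange_big_dep xpredT) //=.
  by apply: eq_bigr => j _; rewrite -big_distrr /= fs mulrC.
rewrite -big_split -sumrB; apply: eq_bigr => i _.
rewrite -big_split -sumrB; apply: eq_bigr => j _ /=.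
by rewrite -!mulrDl -mulrBl; congr (_ * _); lra.
Qed.

Lemma dual_bound (R : realType) (M N : nat) (T : transport_problem R M N)
    (u : 'I_M -> R) (p : 'I_N -> R) (f : 'I_M -> 'I_N -> R) :
  feasible_plan T f ->
  (forall i j, j \in adj T i -> cost T i j - p j <= u i) ->
  primal_cost T f <= \sum_i demand T i * u i + \sum_j supply T j * p j.
Proof.
move=> ff up; rewrite (primal_cost_split u p ff).
rewrite gerBl; apply: sumr_ge0 => i _; apply: sumr_ge0 => j ji.
have [_ _ /(_ i j ji) /andP [f0 _]] := ff.
by apply: mulr_ge0 => //; have := up i j ji; lra.
Qed.

(** The multiplication by [f i j] makes the hypothesis void on unused arcs. *)
Lemma slackness_gap (R : realType) (M N : nat) (T : transport_problem R M N)
    (eps : R) (u : 'I_M -> R) (p : 'I_N -> R) (f : 'I_M -> 'I_N -> R) :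
  feasible_plan T f ->
  (forall i j, j \in adj T i ->
     (u i - eps) * f i j <= (cost T i j - p j) * f i j) ->
  \sum_i demand T i * u i + \sum_j supply T j * p j
    <= primal_cost T f + (\sum_i demand T i) * eps.
Proof.
move=> ff up; rewrite (primal_cost_split u p ff).
rewrite -addrA lerDl addrC subr_ge0 mulr_suml.
apply: ler_sum => i _; have [fd _ _] := ff.
rewrite -fd mulr_suml; apply: ler_sum => j ji.
by have := up i j ji; nra.
Qed.

Lemma ex_best_margin (R : realType) (M N : nat) (T : transport_problem R M N)
    (p : 'I_N -> R) (i : 'I_M) :
  exists u, (forall k, k \in adj T i -> cost T i k - p k <= u) /\
    exists2 k, k \in adj T i & u = cost T i k - p k.
Proof.
have /set0Pn [k0 k0i] := adj_neq0 T i.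
case: (@Order.TotalTheory.arg_maxP _ _ _ k0 (mem (adj T i))
         (fun k => cost T i k - p k) k0i) => k ki kmax.
by exists (cost T i k - p k); split; [exact: kmax | exists k].
Qed.

(** The prices alone form the certificate: the other half [u] of the dual
    solution is read off as the best margin of each sink. *)
Lemma slackness_near_optimal (R : realType) (M N : nat)
    (T : transport_problem R M N) (eps : R) (p : 'I_N -> R)
    (f g : 'I_M -> 'I_N -> R) :
  feasible_plan T f -> feasible_plan T g ->
  (forall i j k, j \in adj T i -> k \in adj T i -> f i j != 0 ->
     cost T i k - p k <= cost T i j - p j + eps) ->
  primal_cost T g - primal_cost T f <= (\sum_i demand T i) * eps.
Proof.
move=> ff fg slack.
have [u uP] := fin_all_exists (ex_best_margin T p).
have le1 : primal_cost T g
    <= \sum_i demand T i * u i + \sum_j supply T j * p j.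
  by apply: dual_bound => // i j ji; apply: (uP i).1.
have : \sum_i demand T i * u i + \sum_j supply T j * p j
    <= primal_cost T f + (\sum_i demand T i) * eps.
  apply: slackness_gap => // i j ji.
  have [-> | fij] := eqVneq (f i j) 0; first by rewrite !mulr0.
  have [_ _ /(_ i j ji) /andP [f0 _]] := ff.
  apply: ler_wpM2r => //.
  have [_ [k ki ->]] := uP i.
  by have := slack i j k ji ki fij; lra.
lra.
Qed.

(** * Prices of claim lists *)

Lemma lot_price_le (R : realType) (M N : nat) (p0 : 'I_N -> R)
    (st : auction_state R M N) (j : 'I_N) :
  all (fun c => lot_price p0 st j <= bid_price c) (claims st j).
Proof.
rewrite /lot_price; case: (claims st j) => [//|c C] /=.
elim: C => [|a C IH]; first by rewrite big_nil lexx.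
rewrite big_cons /= !ge_min lexx /=.
have /andP [-> /= all_le] := IH.
by rewrite orbT /=; apply: sub_all all_le => d dle; rewrite ge_min dle orbT.
Qed.

Lemma le_lot_price (R : realType) (M N : nat) (p0 : 'I_N -> R)
    (st : auction_state R M N) (j : 'I_N) (x : R) :
  all (fun c => x <= bid_price c) (claims st j) ->
  (claims st j = [::] -> x <= p0 j) -> x <= lot_price p0 st j.
Proof.
rewrite /lot_price; case: (claims st j) => [_|c C /= + _]; first exact.
case/andP=> xc; elim: C => [|a C IH]; first by rewrite big_nil.
by rewrite big_cons /= le_min => /andP [-> /IH].
Qed.

(** * Conservation of quantities *)

Definition conserved (R : realType) (M N : nat) (T : transport_problem R M N)
    (st : auction_state R M N) : Prop :=
  (forall i, unsatisfied st i + \sum_j resulting_plan st i j = demand T i) /\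
  (forall j, available st j + \sum_i resulting_plan st i j = supply T j).

(** A withdrawal from a claim is the case of a negative [t], and a new claim
    that of a positive [t]. *)
Lemma conserved_transfer (R : realType) (M N : nat)
    (T : transport_problem R M N) (st st' : auction_state R M N)
    (i0 : 'I_M) (j0 : 'I_N) (t : R) :
  (forall i j, resulting_plan st' i j
     = resulting_plan st i j + (if (i == i0) && (j == j0) then t else 0)) ->
  (forall i, unsatisfied st' i
     = unsatisfied st i - (if i == i0 then t else 0)) ->
  (forall j, available st' j
     = available st j - (if j == j0 then t else 0)) ->
  conserved T st -> conserved T st'.
Proof.
move=> Ep Eu Ea [cu ca]; split=> [i | j].
- rewrite Eu -(cu i) (eq_bigr _ (fun j _ => Ep i j)) big_split /=.
  have -> : \sum_j (if (i == i0) && (j == j0) then t else 0)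
      = if i == i0 then t else 0.
    case: (i == i0) => /=; last by rewrite big1.
    by rewrite -big_mkcond big_pred1_eq.
  lra.
- rewrite Ea -(ca j) (eq_bigr _ (fun i _ => Ep i j)) big_split /=.
  have -> : \sum_i (if (i == i0) && (j == j0) then t else 0)
      = if j == j0 then t else 0.
    case: (j == j0) => /=; last by rewrite big1 // => i; rewrite andbF.
    under eq_bigr do rewrite andbT.
    by rewrite -big_mkcond big_pred1_eq.
  lra.
Qed.

Lemma conserved_take (R : realType) (M N : nat) (T : transport_problem R M N)
    (st : auction_state R M N) (j : 'I_N) (C1 : seq (claim R M))
    (c : claim R M) (C2 : seq (claim R M)) (r : R) :
  claims st j = C1 ++ c :: C2 ->
  conserved T st -> conserved T (take_from_claim st j C1 c C2 r).
Proof.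
move=> Cj; apply: (@conserved_transfer _ _ _ _ _ _ (bidder c) j (- r)).
- move=> i k; rewrite /resulting_plan /=.
  have [-> | _] := eqVneq k j; last by rewrite andbF addr0.
  rewrite Cj !big_cat big_cons /= andbT (eq_sym i).
  have [rest0 | rest0] := eqVneq (quantity c - r) 0.
    rewrite big_nil; case: (bidder c == i); lra.
  rewrite big_cons big_nil /=; case: (bidder c == i); lra.
- by move=> i /=; case: eqVneq => [->|_]; rewrite ?opprK ?subr0.
- by move=> k /=; case: eqVneq => [->|_]; rewrite ?opprK ?subr0.
Qed.

Lemma conserved_place (R : realType) (M N : nat) (T : transport_problem R M N)
    (st : auction_state R M N) (i : 'I_M) (j : 'I_N) (b q : R) :
  conserved T st -> conserved T (place_claim st i j b q).
Proof.
rewrite /place_claim; case: ifP => // _; set r := Num.min _ _.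
apply: (@conserved_transfer _ _ _ _ _ _ i j r).
- move=> l k; rewrite /resulting_plan /=.
  have [-> | _] := eqVneq k j; last by rewrite andbF addr0.
  by rewrite big_cons /= andbT eq_sym; case: (l == i); rewrite ?addr0 1?addrC.
- by move=> l /=; case: eqVneq => [->|_]; rewrite ?subr0.
- by move=> k /=; case: eqVneq => [->|_]; rewrite ?subr0.
Qed.

(** * The invariant of the claims phase *)

(** [pi] stands for the prices at the start of the iteration, fixed while the
    actual prices move.  The lower bound on [bid_price c] keeps the price of
    [j] from ending below [pi j]; the last clause is the slackness condition at
    the price of the claim.  It skips [j] because the bid raises the price of
    [j] itself, by an amount that has no bound. *)
Definition justified (R : realType) (M N : nat) (T : transport_problem R M N)
    (eps : R) (pi : 'I_N -> R) (j : 'I_N) (c : claim R M) : bool :=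
  [&& 0 < quantity c, j \in adj T (bidder c), pi j <= bid_price c &
    [forall k in adj T (bidder c), (k != j) ==>
      (cost T (bidder c) k - pi k <= cost T (bidder c) j - bid_price c + eps)]].

Definition sound (R : realType) (M N : nat) (T : transport_problem R M N)
    (eps : R) (pi : 'I_N -> R) (st : auction_state R M N) : Prop :=
  [/\ conserved T st, forall i, 0 <= unsatisfied st i,
      forall j, 0 <= available st j &
      forall j, all (justified T eps pi j) (claims st j)].

Lemma resulting_plan_ge0 (R : realType) (M N : nat)
    (T : transport_problem R M N) (eps : R) (pi : 'I_N -> R)
    (st : auction_state R M N) (i : 'I_M) (j : 'I_N) :
  sound T eps pi st -> 0 <= resulting_plan st i j.
Proof.
case=> _ _ _ /(_ j); rewrite /resulting_plan.
elim: (claims st j) => [_ | c C IH /= /andP [/and4P [c0 _ _ _] /IH]].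
  by rewrite big_nil.
by rewrite big_cons; case: ifP => // _; apply: addr_ge0; apply: ltW.
Qed.

Lemma sound_take (R : realType) (M N : nat) (T : transport_problem R M N)
    (eps : R) (pi : 'I_N -> R) (st : auction_state R M N) (j : 'I_N)
    (C1 : seq (claim R M)) (c : claim R M) (C2 : seq (claim R M)) (r : R) :
  claims st j = C1 ++ c :: C2 -> 0 <= r -> r <= quantity c ->
  sound T eps pi st -> sound T eps pi (take_from_claim st j C1 c C2 r).
Proof.
move=> Cj r0 rc [cons u0 a0 jst]; split.
- exact: conserved_take.
- by move=> i /=; case: eqP => _; rewrite ?addr_ge0.
- by move=> k /=; case: eqP => _; rewrite ?addr_ge0.
move=> k /=; case: eqP => [-> | _]; last exact: jst.
have := jst j; rewrite Cj !all_cat /= => /and3P [-> cjst ->].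
rewrite andbT /=; have [//|rest0] := eqVneq (quantity c - r) 0.
case/and4P: cjst => [_ adjc bc cc] /=.
by rewrite andbT; apply/and4P; split; rewrite //= lt_neqAle eq_sym rest0 subr_ge0.
Qed.

(** A loop step by sink [i] against its own claim raises the desired quantity
    and the unsatisfied demand of [i] by the same amount, so the former never
    exceeds the latter. *)
Lemma sound_make_room (R : realType) (M N : nat) (T : transport_problem R M N)
    (eps : R) (pi p0 : 'I_N -> R) (i : 'I_M) (j : 'I_N) (b : R)
    (st : auction_state R M N) (q : R) (st' : auction_state R M N) (q' : R) :
  make_room p0 i j b st q st' q' ->
  sound T eps pi st -> 0 < q -> q <= unsatisfied st i ->
  [/\ sound T eps pi st', 0 < q', q' <= unsatisfied st' i,
      forall l, unsatisfied st l <= unsatisfied st' l &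
      forall k, k != j -> claims st' k = claims st k].
Proof.
elim=> {st q st' q'} [st q _ | st q C1 c C2 st' q' _ _ Cj _ q1 r _ IH] snd q0 qu.
  by split.
have c0 : 0 < quantity c.
  have [_ _ _ /(_ j)] := snd.
  by rewrite Cj all_cat /= => /and3P [_ /and4P []].
have qq1 : q <= q1 by rewrite /q1; case: ifP => // _; lra.
have q10 : 0 < q1 by lra.
have r0 : 0 < r by rewrite lt_min q10.
have rc : r <= quantity c by rewrite ge_min lexx orbT.
have q1u : q1 <= unsatisfied (take_from_claim st j C1 c C2 r) i.
  rewrite /= /r /q1; case: eqVneq => [-> | _] //.
  by rewrite min_r; lra.
have [snd' q'0 q'u mono same] := IH (sound_take Cj (ltW r0) rc snd) q10 q1u.
split=> // [l | k kj].
- apply: le_trans (mono l) => /=.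
  by case: eqVneq => [->|//]; rewrite lerDl ltW.
- by rewrite same //= (negPf kj).
Qed.

(** The lot that receives the bid always ends up with a nonempty claim list.
    If the loop has emptied the list, then by conservation the whole supply is
    available and the bid is placed.  So a price never falls back to its
    initial value. *)
Lemma sound_process_bid (R : realType) (M N : nat)
    (T : transport_problem R M N) (eps : R) (pi p0 : 'I_N -> R)
    (i : 'I_M) (j : 'I_N) (b q : R) (st st' : auction_state R M N) :
  process_bid p0 i j b q st st' ->
  (forall r, 0 < r -> justified T eps pi j (Claim i b r)) ->
  sound T eps pi st -> 0 < q -> q <= unsatisfied st i ->
  [/\ sound T eps pi st',
      forall l, l != i -> unsatisfied st l <= unsatisfied st' l &
      forall k, claims st' k = [::] -> claims st k = [::]].
Proof.
move=> [st1 [q1 [room ->]]] jst snd q0 qu.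
have [snd1 q10 q1u mono same] := sound_make_room room snd q0 qu.
have [cons1 u1 a1 jst1] := snd1.
have cons2 := conserved_place i j b q1 cons1.
move: cons2; rewrite /place_claim; set r := Num.min _ _.
case: ifP => [r0 | r0] cons2; split=> //.
- split=> //=.
  + move=> l; case: eqVneq => [_|//].
    by rewrite subr_ge0; apply: le_trans q1u; rewrite ge_min lexx.
  + move=> k; case: eqVneq => [_|//].
    by rewrite subr_ge0 ge_min lexx orbT.
  + by move=> k; case: eqVneq => [->|//] /=; rewrite jst //=.
- by move=> l /= /negPf ->.
- by move=> k /=; case: eqVneq => // kj; rewrite same.
- move=> k; have [-> C1 | kj] := eqVneq k j; last by rewrite same.
  have : available st1 j = supply T j.
    rewrite -(cons1.2 j) big1 ?addr0 // => l _.
    by rewrite /resulting_plan C1 big_nil.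
  by move=> aE; move: r0; rewrite /r lt_min q10 aE supply_gt0.
Qed.

Lemma sound_process_bids (R : realType) (M N : nat)
    (T : transport_problem R M N) (eps : R) (pi p0 : 'I_N -> R)
    (lot : 'I_M -> 'I_N) (b q : 'I_M -> R) (s : seq 'I_M)
    (st st' : auction_state R M N) :
  process_bids p0 lot b q s st st' ->
  uniq s ->
  (forall i r, i \in s -> 0 < r ->
     justified T eps pi (lot i) (Claim i (b i) r)) ->
  (forall i, i \in s -> 0 < q i <= unsatisfied st i) ->
  sound T eps pi st ->
  sound T eps pi st' /\ forall k, claims st' k = [::] -> claims st k = [::].
Proof.
elim=> {s st st'} [//| i s st st1 st' bid _ IH] /= /andP [is_ us] jst qst snd.
have /andP [q0 qu] := qst i (mem_head i s).
have [snd1 mono ne1] := sound_process_bid bid (fun r => jst i r (mem_head i s)) snd q0 qu.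
have [||snd' ne'] := IH us _ _ snd1.
- by move=> l r ls; apply: jst; rewrite inE ls orbT.
- move=> l ls; have /andP [-> ql] : 0 < q l <= unsatisfied st l.
    by apply: qst; rewrite inE ls orbT.
  by apply: le_trans ql (mono _ _); apply: contraNneq is_ => <-.
by split=> // k /ne' /ne1.
Qed.

Lemma uniq_flatten_fibers (A B : eqType) (h : A -> B) (ord : B -> seq A)
    (js : seq B) :
  uniq js -> (forall j, uniq (ord j)) ->
  (forall j x, x \in ord j -> h x = j) ->
  uniq (flatten [seq ord j | j <- js]).
Proof.
move=> + uo ho; elim: js => //= j js IH /andP [jjs /IH ujs].
rewrite cat_uniq uo ujs andbT /=.
apply/hasPn => x /flattenP [_ /mapP [k kjs ->] xk].
by apply: contra jjs => /ho <-; rewrite (ho _ _ xk).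
Qed.

(** * One iteration *)

(** The bid price is the one at which the margin of the sink falls [eps] below
    the best margin [w] on the other lots.  It exceeds the old price because
    [w] is at most the margin at the chosen lot, also when that lot is the only
    one and [w] is arbitrary below this margin. *)
Lemma bid_justified (R : realType) (M N : nat) (T : transport_problem R M N)
    (eps : R) (p0 : 'I_N -> R) (st : auction_state R M N)
    (i : 'I_M) (j : 'I_N) (w r : R) :
  0 < eps -> best_lot T p0 st i j -> second_margin T p0 st i j w -> 0 < r ->
  justified T eps (lot_price p0 st) j (Claim i (cost T i j - w + eps) r).
Proof.
move=> eps0 [ji best] + r0; rewrite /second_margin => wP.
have [w_le w_ge] : w <= margin T p0 st i j /\
    forall k, k \in adj T i -> k != j -> margin T p0 st i k <= w.
  move: wP; case: eqP => [adj1 /ltW wlt | _ [[k [ki _ ->]] wmax]].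
    by split=> // k; rewrite adj1 inE => ->.
  by split=> [|l li lj]; [exact: best | apply: wmax; exists l].
move: w_le w_ge; rewrite /margin => w_le w_ge.
apply/and4P; split=> //=; first by lra.
apply/forall_inP => k ki; apply/implyP => kj.
by have := w_ge k ki kj; lra.
Qed.

(** Since prices do not drop over an iteration, claims justified by the old
    prices are justified by the new ones. *)
Lemma sound_iteration (R : realType) (M N : nat) (T : transport_problem R M N)
    (p0 : 'I_N -> R) (eps : R) (st st' : auction_state R M N) :
  0 < eps -> iteration T p0 eps st st' ->
  sound T eps (lot_price p0 st) st -> sound T eps (lot_price p0 st') st'.
Proof.
move=> eps0 [It [lot [w [_ unsat best second [js [ord [js_perm ord_perm bids]]]]]]] snd.
have ordE j i : (i \in ord j) = (i \in It) && (lot i == j).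
  by rewrite (perm_mem (ord_perm j)) mem_enum inE.
have memIt i : i \in flatten [seq ord j | j <- js] -> i \in It.
  by case/flattenP=> _ /mapP [j _ ->]; rewrite ordE => /andP [].
have [||||snd' ne] := @sound_process_bids _ _ _ T eps (lot_price p0 st) _ _ _ _ _ _ _ bids.
- apply: (@uniq_flatten_fibers _ _ lot).
  + by rewrite (perm_uniq js_perm) enum_uniq.
  + by move=> j; rewrite (perm_uniq (ord_perm j)) enum_uniq.
  + by move=> j i; rewrite ordE => /andP [_ /eqP].
- by move=> i r /memIt iI; apply: bid_justified; [| exact: best | exact: second].
- move=> i /memIt iI; rewrite ge_min lexx lt_min supply_gt0 !andbT.
  have [_ /(_ i) u0 _ _] := snd.
  by rewrite lt_neqAle u0 eq_sym andbT; apply/eqP; exact: unsat.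
- exact: snd.
have [cons u0 a0 jst] := snd'.
have mono k : lot_price p0 st k <= lot_price p0 st' k.
  apply: le_lot_price => [|/ne E]; last by rewrite /lot_price E.
  by apply: sub_all (jst k) => c /and4P [].
split=> // j.
elim: (claims st' j) (jst j) (lot_price_le p0 st' j) => //= c C IH.
case/andP=> /and4P [c0 ac _ /forall_inP cc] /IH{}IH /andP [cp /IH ->].
rewrite andbT; apply/and4P; split=> //.
apply/forall_inP => k ka; apply/implyP => kj.
by have /implyP/(_ kj) := cc k ka; have := mono k; lra.
Qed.

Lemma sound_reachable (R : realType) (M N : nat) (T : transport_problem R M N)
    (p0 : 'I_N -> R) (eps : R) (st : auction_state R M N) :
  0 < eps -> reachable T p0 eps st -> sound T eps (lot_price p0 st) st.
Proof.
move=> eps0; elim=> {st} [| st st' _ snd it]; last exact: sound_iteration it snd.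
split=> //= [|i|j]; last 2 first.
- exact/ltW/demand_gt0.
- exact/ltW/supply_gt0.
by split=> k; rewrite big1 ?addr0 // => l _; rewrite /resulting_plan big_nil.
Qed.

(** * The final plan *)

Lemma resulting_plan_neq0 (R : realType) (M N : nat)
    (st : auction_state R M N) (i : 'I_M) (j : 'I_N) :
  resulting_plan st i j != 0 -> has (fun c => bidder c == i) (claims st j).
Proof.
by apply: contraNT => no_i; rewrite /resulting_plan big_hasC.
Qed.

Lemma resulting_plan_slack (R : realType) (M N : nat)
    (T : transport_problem R M N) (p0 : 'I_N -> R) (eps : R)
    (st : auction_state R M N) (i : 'I_M) (j : 'I_N) :
  0 < eps -> sound T eps (lot_price p0 st) st -> resulting_plan st i j != 0 ->
  j \in adj T i /\
  forall k, k \in adj T i ->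
    cost T i k - lot_price p0 st k <= cost T i j - lot_price p0 st j + eps.
Proof.
move=> eps0 [_ _ _ /(_ j) +] /resulting_plan_neq0.
elim: (claims st j) => //= c C IH /andP [/and4P [_ ac bc /forall_inP cc] aC].
case/orP=> [/eqP ci | /IH]; last by apply.
subst i; split=> // k ka.
have [-> | kj] := eqVneq k j; first by lra.
by have /implyP/(_ kj) := cc k ka; lra.
Qed.

Lemma resulting_plan_feasible (R : realType) (M N : nat)
    (T : transport_problem R M N) (p0 : 'I_N -> R) (eps : R)
    (st : auction_state R M N) :
  0 < eps -> sound T eps (lot_price p0 st) st ->
  (forall i, unsatisfied st i = 0) -> feasible_plan T (resulting_plan st).
Proof.
move=> eps0 snd u0; have [[cu ca] _ a0 _] := snd.
have f0 i j : 0 <= resulting_plan st i j by exact: resulting_plan_ge0 snd.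
have out i j : j \notin adj T i -> resulting_plan st i j = 0.
  by apply: contraNeq => /(resulting_plan_slack eps0 snd) [].
have fd i : \sum_j resulting_plan st i j = demand T i.
  by rewrite -cu u0 add0r.
have avail0 j : available st j = 0.
  (* The total supply equals the total demand, which has all been shipped. *)
  have : \sum_j available st j = 0.
    have := balanced T; rewrite -(eq_bigr _ (fun j _ => ca j)) big_split /=.
    rewrite -(eq_bigr _ (fun i _ => fd i)) exchange_big /=; lra.
  by move/(psumr_eq0P (fun j _ => a0 j)) => /(_ j isT).
have fs j : \sum_i resulting_plan st i j = supply T j.
  by rewrite -ca avail0 add0r.
split=> [i | j | i j _].
- rewrite -fd big_mkcond; apply: eq_bigr => j _ /=.
  by case: ifPn => // /out.
- rewrite -fs big_mkcond; apply: eq_bigr => i _ /=.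
  by case: ifPn => // /out.
- rewrite f0 le_min -fd -fs (bigD1 j) //= (bigD1 i) //= !lerDl.
  by apply/andP; split; apply: sumr_ge0.
Qed.

Unset Implicit Arguments.

Theorem theorem5 (R : realType) (M N : nat) (T : transport_problem R M N)
    (p0 : 'I_N -> R) (hp0 : forall j, 0 <= p0 j)
    (eps : R) (heps : 0 < eps)
    (hfeas : exists f, feasible_plan T f)
    (st : auction_state R M N) (hst : terminates_in T p0 eps st) :
  feasible_plan T (resulting_plan st) /\
  exists L : R,
    [/\ L = \sum_i demand T i, L = \sum_j supply T j &
        forall P : R, optimal_primal_cost T P ->
          P - primal_cost T (resulting_plan st) <= L * eps].
Proof.
have [reach u0] := hst.
have snd := sound_reachable heps reach.
have feas := resulting_plan_feasible heps snd u0.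
split=> //; exists (\sum_i demand T i); split=> //; first exact: balanced.
move=> P [[g fg ->] _].
apply: (@slackness_near_optimal _ _ _ T eps (lot_price p0 st)) => // i j k _ ki f0.
by have [_] := resulting_plan_slack heps snd f0; apply.
Qed.
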